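(* Assume $w_i=1$ for all $i\in N$, and let $\alpha_{\mathrm{pes}}$ be the maximum cardinality of an independent set of the pessimistic interval graph $G_{\mathrm{pes}}$. Then there is a minimum clique cover of $G_{\mathrm{pes}}$, given by a set $\mathcal{J}\subseteq M$ with $|\mathcal{J}|=\alpha_{\mathrm{pes}}$ (the slot $k\in\mathcal{J}$ representing the clique $\{i\in N: k\in[a_i,d_i]\}$), such that for each task $i\in N$ there is exactly one $k\in\mathcal{J}$ with $k\in[a_i,d_i]$. Denote this unique element by $k_i$. Let $\alpha$ be the optimal value of the linear program (in nonnegative variables $x_i^t,x_{ik}^{ts},x_{ik}^{te}$, $i\in N$, $k\in M$, $t\in T$) $$\begin{aligned}\max\quad & \sum_{t\in T}\sum_{i\in N} w_i x_i^t\\ \text{s.t.}\quad & x_i^t=\sum_{k=1}^m x_{ik}^{ts}=\sum_{k=1}^m x_{ik}^{te},\quad\forall i\in N,\ t\in T,\\ & x_{ik}^{ts}=0,\quad\forall i\in N,\ t\in T,\ k\notin[a_i,b_i],\\ & x_{ik}^{te}=0,\quad\forall i\in N,\ t\in T,\ k\notin[c_i,d_i],\\ & \sum_{t\in T}\Bigl(\sum_{i:\,a_i\le k\le d_i}x_i^t-\sum_{i:\,a_i\le k\le b_i}\sum_{\ell=k+1}^{b_i}x_{i\ell}^{ts}-\sum_{i:\,c_i\le k\le d_i}\sum_{\ell=c_i}^{k-1}x_{i\ell}^{te}\Bigr)\le 1,\quad\forall k\in M,\\ & \sum_{t\in T}x_{ik}^{ts}\le P^s_{ik},\quad \sum_{t\in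 T}x_{ik}^{te}\le P^e_{ik},\quad\forall i\in N,\ k\in M.\end{aligned}$$ Then $$\alpha\ \le\ \alpha_{\mathrm{pes}}+\sum_{i\in N}\bigl(1-P^o_{ik_i}\bigr).$$
   Context: Slots $M=[m]=\{1,\dots,m\}$, tasks $N=[n]$ with weights $w_i$, stages $T=[\min\{m,n\}]$. Each task $i\in N$ has independent random start time $s_i$ and end time $e_i$ in $M$ with discrete distributions having supports $S_i,E_i\subseteq M$, with $\max S_i\le\min E_i$. Put $a_i=\min S_i$, $b_i=\max S_i$, $c_i=\min E_i$, $d_i=\max E_i$. $P^s_{ik}=\Pr[s_i=k]$, $P^e_{ik}=\Pr[e_i=k]$, and $P^o_{ik}=\Pr[s_i\le k\le e_i]$ are the probabilities that task $i$ starts at, ends at, and occupies slot $k$. The pessimistic interval graph $G_{\mathrm{pes}}$ has vertex set $N$, with distinct $i,j$ adjacent iff the integer intervals $[a_i,d_i]$ and $[a_j,d_j]$ intersect. Empty sums are $0$.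
   Formalization: A cover J meeting each window exactly once need not exist (windows [1,1], [3,3], [1,3]); instead a minimum clique cover J with |J| = α_pes meeting each window at least once is shown to exist, and the bound is proved for every such J and every choice of k_i in J with k_i in [a_i,d_i]. *)

(* Defs.v *)
From HB Require Import structures.
From mathcomp Require Import all_boot all_order all_algebra.
From mathcomp Require Import all_classical all_reals all_analysis.

Set Implicit Arguments.
Unset Strict Implicit.
Unset Printing Implicit Defensive.

Import Order.TTheory GRing.Theory Num.Theory.
Local Open Scope classical_set_scope.
Local Open Scope ring_scope.

(* Slots [m] = {1, ..., m} are represented by 'I_m, slot k + 1 being k : 'I_m. *)

Section Graph.
Variable V : finType.
Implicit Types (e : rel V) (A : {set V}) (F : {set {set V}}).

Definition independent e A : bool :=
  [forall i in A, forall j in A, ~~ e i j].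

Definition independence_number e : nat :=
  \max_(A : {set V} | independent e A) #|A|.

Definition is_clique e A : bool :=
  [forall i in A, forall j in A, (i != j) ==> e i j].

Definition clique_cover e F : bool :=
  [forall A in F, is_clique e A] && (finset.cover F == [set: V]%SET).

Definition minimum_clique_cover e F : Prop :=
  clique_cover e F /\
  forall F' : {set {set V}}, clique_cover e F' -> (#|F| <= #|F'|)%N.

End Graph.

Section RandomSlots.
Context {disp : measure_display} {Omega : measurableType disp} {R : realType}.
Variables (P : probability Omega R) (m : nat).
Implicit Types X Y : Omega -> 'I_m.

(* 'I_m is finite with the discrete sigma-algebra: fibers suffice. *)
Definition slot_rv X : Prop := forall k : 'I_m, measurable (X @^-1` [set k]).

Definition Pr (E : set Omega) : R := fine (P E).

Definition slot_pmf X (k : 'I_m) : R := Pr [set o | X o = k].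

Definition slot_indep X Y : Prop :=
  forall k l : 'I_m,
    Pr [set o | X o = k /\ Y o = l] = slot_pmf X k * slot_pmf Y l.

Definition slot_supp X : {set 'I_m} := [set k | 0 < slot_pmf X k]%SET.

(* The default value m is not attained by a slot; a support is never empty. *)
Definition supp_min X : nat := \big[minn/m]_(k in slot_supp X) (k : nat).

Definition supp_max X : nat := (\max_(k in slot_supp X) (k : nat))%N.

Definition prob_occupied X Y (k : 'I_m) : R :=
  Pr [set o | (X o <= k <= Y o)%N].

End RandomSlots.

Section IntervalGraph.
Variables (n : nat) (a d : 'I_n -> nat).

Definition interval_graph : rel 'I_n :=
  fun i j => (i != j) && (maxn (a i) (a j) <= minn (d i) (d j))%N.

Definition slot_clique m (k : 'I_m) : {set 'I_n} :=
  [set i | (a i <= k <= d i)%N]%SET.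

Definition slot_cover m (J : {set 'I_m}) : Prop :=
  #|J| = independence_number interval_graph /\
  minimum_clique_cover interval_graph [set slot_clique k | k in J]%SET.

(* kk assigns every task i to exactly one clique of the cover that contains i.
   An interval [a i, d i] may contain several slots of J (for the intervals
   [0, 0], [2, 2] and [0, 2], J must contain 0 and 2), so kk is a choice; it is
   the unique one when every interval contains exactly one slot of J. *)
Definition slot_assignment m (J : {set 'I_m}) (kk : 'I_n -> 'I_m) : Prop :=
  forall i, kk i \in J /\ (a i <= kk i <= d i)%N.

End IntervalGraph.

Section LinearProgram.
Variables (R : realType) (m n : nat).
Variables (w : 'I_n -> R) (a b c d : 'I_n -> nat).
Variables (Ps Pe : 'I_n -> 'I_m -> R).

Record lp_point := LpPoint {
  lp_x  : 'I_(minn m n) -> 'I_n -> R;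
  lp_xs : 'I_(minn m n) -> 'I_n -> 'I_m -> R;
  lp_xe : 'I_(minn m n) -> 'I_n -> 'I_m -> R }.

Implicit Type z : lp_point.

Definition lp_obj z : R :=
  \sum_(t < minn m n) \sum_(i < n) w i * lp_x z t i.

Definition lp_slot_load z (k : 'I_m) : R :=
  \sum_(t < minn m n)
    (\sum_(i < n | (a i <= k <= d i)%N) lp_x z t i
     - \sum_(i < n | (a i <= k <= b i)%N)
         \sum_(l < m | (k < l <= b i)%N) lp_xs z t i l
     - \sum_(i < n | (c i <= k <= d i)%N)
         \sum_(l < m | (c i <= l < k)%N) lp_xe z t i l).

Record lp_feasible z : Prop := LpFeasible {
  lp_x_ge0  : forall t i, 0 <= lp_x z t i;
  lp_xs_ge0 : forall t i k, 0 <= lp_xs z t i k;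
  lp_xe_ge0 : forall t i k, 0 <= lp_xe z t i k;
  lp_start  : forall t i, lp_x z t i = \sum_(k < m) lp_xs z t i k;
  lp_end    : forall t i, lp_x z t i = \sum_(k < m) lp_xe z t i k;
  lp_xs_out : forall t i (k : 'I_m), ~~ (a i <= k <= b i)%N -> lp_xs z t i k = 0;
  lp_xe_out : forall t i (k : 'I_m), ~~ (c i <= k <= d i)%N -> lp_xe z t i k = 0;
  lp_load   : forall k, lp_slot_load z k <= 1;
  lp_xs_le  : forall i k, \sum_(t < minn m n) lp_xs z t i k <= Ps i k;
  lp_xe_le  : forall i k, \sum_(t < minn m n) lp_xe z t i k <= Pe i k }.

(* For Ps, Pe >= 0 the feasible set is nonempty (it contains 0) and compact,
   so that this supremum is an attained maximum. *)
Definition lp_value : R := sup [set lp_obj z | z in [set z | lp_feasible z]].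

End LinearProgram.

(* Main.v *)
Require Import Defs.
From HB Require Import structures.
From mathcomp Require Import all_boot all_order all_algebra.
From mathcomp Require Import all_classical all_reals all_analysis.

Local Open Scope ring_scope.

(** Each task contributes a nonnegative amount to the load of every slot of its
    window [a i, d i].  Summing the load constraints over the slots of J and
    keeping, for each task, only the contribution at kk i bounds the objective
    by #|J| plus the mass subtracted at kk i, which is mass of the event that
    the task does not occupy kk i.  A hitting set J of size alpha_pes comes
    from the greedy algorithm by earliest end, which produces an independent
    set of the same size. *)

Set Implicit Arguments.
Unset Strict Implicit.
Unset Printing Implicit Defensive.

Import Order.TTheory GRing.Theory Num.Theory.

(** * Independent sets against clique covers in an arbitrary graph *)

Section CliqueCovers.
Variables (V : finType) (e : rel V).

(** Weak duality: a clique contains at most one vertex of an independent set, so sending each vertex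
    of [A] to a member of [F] that contains it is injective. *)
Lemma independent_card_le_clique_cover (A : {set V}) (F : {set {set V}}) :
  independent e A -> clique_cover e F -> (#|A| <= #|F|)%N.
Proof.
move=> /forall_inP indA /andP[/forall_inP cliqueF /eqP coverF].
have inF (i : V) : exists B : {set V}, (B \in F) && (i \in B).
  have : i \in finset.cover F by rewrite coverF finset.in_setT.
  by case/bigcupP => B BF iB; exists B; rewrite BF.
pose f i := xchoose (inF i).
have fP i : f i \in F /\ i \in f i by apply/andP; exact: xchooseP (inF i).
have f_inj : {in A &, injective f}.
  move=> i j iA jA fij; apply/eqP; apply/negPn/negP => neq_ij.
  have /forall_inP/(_ i (fP i).2)/forall_inP/(_ j) := cliqueF _ (fP i).1.
  rewrite {1}fij (fP j).2 neq_ij => /(_ isT) /= eij.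
  by have /forall_inP/(_ j jA) := indA i iA; rewrite eij.
rewrite -(card_in_imset f_inj); apply/subset_leq_card/fintype.subsetP.
by move=> _ /imsetP[i iA ->]; exact: (fP i).1.
Qed.

Lemma independence_number_le_clique_cover (F : {set {set V}}) :
  clique_cover e F -> (independence_number e <= #|F|)%N.
Proof.
by move=> covF; apply/bigmax_leqP => A indA; exact: independent_card_le_clique_cover.
Qed.

End CliqueCovers.

(** * Hitting sets of slots and minimum clique covers of interval graphs *)

Section IntervalGraphs.
Variables (n m : nat) (a d : 'I_n -> nat).

Lemma slot_clique_cover (J : {set 'I_m}) :
  (forall i, exists2 k : 'I_m, k \in J & (a i <= k <= d i)%N) ->
  clique_cover (interval_graph a d) [set slot_clique a d k | k in J]%SET.
Proof.
move=> hit; apply/andP; split.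
  apply/forall_inP => _ /imsetP[k _ ->].
  apply/forall_inP => i; rewrite inE => /andP[aik kdi].
  apply/forall_inP => j; rewrite inE => /andP[ajk kdj].
  apply/implyP => neq_ij; rewrite /interval_graph neq_ij /=.
  apply: (@leq_trans k).
    by rewrite geq_max aik.
  by rewrite leq_min kdi.
apply/eqP/finset.setP => i; rewrite finset.in_setT; apply/bigcupP.
have [k kJ ik] := hit i.
by exists (slot_clique a d k); [apply: imset_f | rewrite inE].
Qed.

Hypothesis a_le_d : forall i, (a i <= d i)%N.
Hypothesis d_lt_m : forall i, (d i < m)%N.

(** Induction on [#|S|]. The earliest end in [S], that of [i0], hits every interval starting no
    later; the remaining intervals lie strictly to its right, so the independent set obtained for
    them can be enlarged by [i0]. *)
Lemma greedy_hitting_set (S : {set 'I_n}) :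
  exists (J : {set 'I_m}) (A : {set 'I_n}),
    [/\ A \subset S, independent (interval_graph a d) A, (#|J| <= #|A|)%N &
        forall i, i \in S -> exists2 k : 'I_m, k \in J & (a i <= k <= d i)%N].
Proof.
have [N] := ubnP #|S|; elim: N S => // N IHN S; rewrite ltnS => leSN.
have [->|[i1 i1S]] := set_0Vmem S.
  exists finset.set0, finset.set0; split=> //.
  - by apply/forall_inP => i; rewrite finset.in_set0.
  - by rewrite !cards0.
  - by move=> i; rewrite finset.in_set0.
have [i0 i0S d_min] : exists2 i0, i0 \in S & forall j, j \in S -> (d i0 <= d j)%N.
  by case: (arg_minnP d i1S) => i0; exists i0.
have lt_card : (#|[set i in S | (d i0 < a i)%N]%SET| < N)%N.
  apply: leq_trans leSN; apply/proper_card/properP; split.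
    by apply/fintype.subsetP => i; rewrite inE => /andP[].
  by exists i0; rewrite // inE i0S -leqNgt a_le_d.
have [J [A [sAS indA leJA hit]]] := IHN _ lt_card.
have A_right j : j \in A -> j \in S /\ (d i0 < a j)%N.
  by move=> /(fintype.subsetP sAS); rewrite inE => /andP[].
have nadj j : j \in A -> ~~ interval_graph a d i0 j /\ ~~ interval_graph a d j i0.
  move=> /A_right[_ d_lt_a]; rewrite /interval_graph !negb_and -!ltnNge.
  by split; rewrite gtn_min !leq_max d_lt_a ?orbT.
pose k0 := Ordinal (d_lt_m i0).
exists (k0 |: J)%SET, (i0 |: A)%SET; split.
- apply/fintype.subsetP => i; rewrite in_setU1 => /orP[/eqP->//|/A_right[]//].
- apply/forall_inP => i; rewrite in_setU1 => iA.
  apply/forall_inP => j; rewrite in_setU1 => jA.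
  case/orP: iA => [/eqP->|iA]; case/orP: jA => [/eqP->|jA].
  + by rewrite /interval_graph eqxx.
  + exact: (nadj j jA).1.
  + exact: (nadj i iA).2.
  + by have /forall_inP/(_ i iA)/forall_inP/(_ j jA) := indA.
(* [i0] is new to [A], whereas [k0] adds at most one to [#|J|] whether or not it already lies
   there. *)
- rewrite !cardsU1.
  have -> : i0 \notin A.
    by apply/negP => /A_right[_]; rewrite ltnNge a_le_d.
  by apply: leq_add => //; case: (_ \notin _).
- move=> i iS; have [d_lt_a|a_le] := ltnP (d i0) (a i).
    have [|k kJ ik] := hit i; first by rewrite inE iS.
    by exists k => //; rewrite in_setU1 kJ orbT.
  by exists k0; rewrite ?in_setU1 ?eqxx //= a_le d_min.
Qed.

Lemma slot_cover_assignment_exists :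
  exists (J : {set 'I_m}) (kk : 'I_n -> 'I_m),
    slot_cover a d J /\ slot_assignment a d J kk.
Proof.
have [J [A [_ indA leJA hitS]]] := greedy_hitting_set [set: 'I_n]%SET.
have hit i : exists2 k : 'I_m, k \in J & (a i <= k <= d i)%N by exact: hitS.
have hitb i : exists k : 'I_m, (k \in J) && (a i <= k <= d i)%N.
  by have [k kJ ik] := hit i; exists k; rewrite kJ.
have covJ := slot_clique_cover hit.
(* Distinct slots may give the same clique, so the cover has at most [#|J|] members. Weak duality
   bounds the independence number by the size of the cover, and the greedy set [A] bounds [#|J|] by
   the independence number, so all these are equal. *)
have leFJ := leq_imset_card (slot_clique a d (m := m)) J.
have le_alpha_J := leq_trans (independence_number_le_clique_cover covJ) leFJ.
have leJ_alpha : (#|J| <= independence_number (interval_graph a d))%N.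
  exact: leq_trans leJA (leq_bigmax_cond _ indA).
exists J, (fun i => xchoose (hitb i)); split.
  split; first by apply/eqP; rewrite eqn_leq leJ_alpha.
  split=> // F' covF'; apply: leq_trans leFJ (leq_trans leJ_alpha _).
  exact: independence_number_le_clique_cover.
by move=> i; have /andP[] := xchooseP (hitb i).
Qed.

End IntervalGraphs.

(** * Probabilities of slot events and supports of slot variables *)

Section SlotProbabilities.
Context {disp : measure_display} {Omega : measurableType disp} {R : realType}.
Variables (P : probability Omega R) (m : nat).
Implicit Types (X Y : Omega -> 'I_m) (Q : pred 'I_m) (E : set Omega).
Local Open Scope classical_set_scope.

Lemma slot_rv_preimage X Q :
  [set o | Q (X o)] = \big[setU/set0]_(k | Q k) (X @^-1` [set k]).
Proof.
apply/seteqP; split=> o /=.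
  by move=> QX; rewrite (bigD1 (X o)) //=; left.
by elim/big_rec: _ => //= k A Qk IH [->//|/IH].
Qed.

Lemma measurable_slot_event X Q : slot_rv X -> measurable [set o | Q (X o)].
Proof. by move=> mX; rewrite slot_rv_preimage; exact: bigsetU_measurable. Qed.

Lemma Pr_slot_event X Q : slot_rv X ->
  Pr P [set o | Q (X o)] = \sum_(k | Q k) slot_pmf P X k.
Proof.
move=> mX; rewrite slot_rv_preimage /Pr measure_bigsetU_ord_cond //.
- rewrite sum_fine// => k _; exact: fin_num_measure (mX k).
- by move=> k l _ _ [x [/= <- <-]].
Qed.

Lemma Pr_setT : Pr P setT = 1.
Proof. by rewrite /Pr probability_setT. Qed.

Lemma Pr_le1_disjoint E E' : measurable E -> measurable E' ->
  E `&` E' = set0 -> Pr P E + Pr P E' <= 1.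
Proof.
move=> mE mE' dis; rewrite /Pr -fineD ?fin_num_measure//.
rewrite -measureU// -[leRHS]/(fine 1%E); apply: fine_le => //.
  by apply: fin_num_measure; exact: measurableU.
by apply: probability_le1; exact: measurableU.
Qed.

(** The point masses sum to 1, so they cannot all vanish. Hence the values of [supp_min] and
    [supp_max] on an empty support never arise. *)
Lemma slot_supp_neq0 X : slot_rv X -> exists k, k \in slot_supp P X.
Proof.
move=> mX; apply: contrapT => /forallNP supp0.
have := Pr_slot_event predT mX; rewrite big1 => [|k _].
  have -> : [set o | predT (X o)] = setT by apply/seteqP; split.
  by rewrite Pr_setT => /eqP; rewrite oner_eq0.
apply/eqP; apply: contra_notT (supp0 k) => pk_neq0.
by rewrite inE lt_neqAle eq_sym pk_neq0 fine_ge0.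
Qed.

Lemma supp_min_le X k : k \in slot_supp P X -> (supp_min P X <= k)%N.
Proof. by move=> kX; rewrite /supp_min -minEnat -leEnat; exact: bigmin_le_cond. Qed.

Lemma supp_min_le_max X : slot_rv X -> (supp_min P X <= supp_max P X)%N.
Proof.
move=> /slot_supp_neq0[k kX]; apply: leq_trans (supp_min_le kX) _.
by rewrite /supp_max; exact: (@leq_bigmax_cond _ _ (fun l : 'I_m => l : nat)).
Qed.

Lemma supp_max_lt X : slot_rv X -> (supp_max P X < m)%N.
Proof.
move=> /slot_supp_neq0[k _]; have m0 : (0 < m)%N by exact: leq_trans (ltn_ord k).
by rewrite -[ltnRHS](prednK m0) ltnS; apply/bigmax_leqP => l _; rewrite -ltnS prednK.
Qed.

Lemma measurable_occupied X Y (k : 'I_m) : slot_rv X -> slot_rv Y ->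
  measurable [set o | (X o <= k <= Y o)%N].
Proof.
move=> mX mY; have -> : [set o | (X o <= k <= Y o)%N] =
    [set o | (X o <= k)%N] `&` [set o | (k <= Y o)%N].
  by apply/seteqP; split=> o /=; [move/andP | move=> [? ?]; apply/andP].
apply: measurableI; first exact: measurable_slot_event (fun l => l <= k)%N mX.
exact: measurable_slot_event (fun l => k <= l)%N mY.
Qed.

Lemma prob_occupied_le1 X Y (k : 'I_m) : slot_rv X -> slot_rv Y ->
  prob_occupied P X Y k <= 1.
Proof.
(* Zero is written as the probability of the empty event, so that the bound for two disjoint events
   applies. *)
move=> mX mY; rewrite -[leLHS]addr0 -[X in _ + X]/(fine 0%E) -(measure0 P).
by apply: Pr_le1_disjoint; rewrite ?setI0//; exact: measurable_occupied.
Qed.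

(** Since [b <= c], at most one of the two sums has any terms: the second is empty if [k <= b], the
    first if [b < k]. The other is the probability of starting after [k], or of ending before [k],
    an event disjoint from occupying [k]. *)
Lemma sum_slot_pmf_le_unoccupied X Y (b c : nat) (k : 'I_m) :
  slot_rv X -> slot_rv Y -> (b <= c)%N ->
  \sum_(l < m | (k < l <= b)%N) slot_pmf P X l +
  \sum_(l < m | (c <= l < k)%N) slot_pmf P Y l <= 1 - prob_occupied P X Y k.
Proof.
move=> mX mY le_bc; rewrite lerBrDr; have [kb|bk] := leqP k b.
  rewrite [X in _ + X + _]big_pred0 => [|l]; last first.
    apply/negP => /andP[cl lk].
    by have := leq_trans (leq_trans kb le_bc) cl; rewrite leqNgt lk.
  rewrite addr0 -(Pr_slot_event (fun l : 'I_m => k < l <= b)%N mX).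
  apply: Pr_le1_disjoint; [|exact: measurable_occupied|].
    exact: measurable_slot_event (fun l => k < l <= b)%N mX.
  by apply/seteqP; split=> o //= [/andP[+ _] /andP[+ _]]; rewrite ltnNge => /negP.
rewrite [X in X + _ + _]big_pred0 => [|l]; last first.
  by apply/negP => /andP[kl lb]; have := leq_trans kl lb; rewrite ltnNge (ltnW bk).
rewrite add0r -(Pr_slot_event (fun l : 'I_m => c <= l < k)%N mY).
apply: Pr_le1_disjoint; [|exact: measurable_occupied|].
  exact: measurable_slot_event (fun l => c <= l < k)%N mY.
by apply/seteqP; split=> o //= [/andP[_ +] /andP[_ +]]; rewrite ltnNge => /negP.
Qed.

End SlotProbabilities.

(** * Bounding the objective at a feasible point of the linear program *)

Section LPBound.
Variables (R : realType) (m n : nat) (w : 'I_n -> R) (a b c d : 'I_n -> nat).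
Variables (Ps Pe : 'I_n -> 'I_m -> R).
Hypothesis le_ab : forall i, (a i <= b i)%N.
Hypothesis le_bc : forall i, (b i <= c i)%N.
Hypothesis le_cd : forall i, (c i <= d i)%N.
Variable z : lp_point R m n.
Hypothesis zP : lp_feasible a b c d Ps Pe z.

(** With [lp_x z t i] read as the scheduled mass of task [i] in stage [t], [late] is the part not
    yet started at slot [k], [early] the part already finished, and [contrib] the part occupying
    [k]. *)
Let late t i (k : 'I_m) := \sum_(l < m | (k < l <= b i)%N) lp_xs z t i l.
Let early t i (k : 'I_m) := \sum_(l < m | (c i <= l < k)%N) lp_xe z t i l.
Let contrib t i k := lp_x z t i - late t i k - early t i k.

Let late0 t i (k : 'I_m) : (b i <= k)%N -> late t i k = 0.
Proof.
move=> bk; apply: big_pred0 => l; apply/negP => /andP[kl lb].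
by have := leq_trans kl lb; rewrite ltnNge bk.
Qed.

Let early0 t i (k : 'I_m) : (k <= c i)%N -> early t i k = 0.
Proof.
move=> kc; apply: big_pred0 => l; apply/negP => /andP[cl lk].
by have := leq_trans kc cl; rewrite leqNgt lk.
Qed.

(** By [le_bc], one of [late] and [early] vanishes at [k]; the other is a partial sum of the starts
    or of the ends, each of which totals [lp_x z t i]. *)
Let contrib_ge0 t i k : 0 <= contrib t i k.
Proof.
rewrite /contrib; have [kb|/ltnW bk] := leqP k (b i).
  rewrite early0 ?(leq_trans kb)// subr0 subr_ge0 (lp_start zP) /late.
  rewrite [leRHS](bigID (fun l : 'I_m => k < l <= b i)%N) /= lerDl.
  by apply: sumr_ge0 => l _; exact: lp_xs_ge0 zP t i l.
rewrite late0// subr0 subr_ge0 (lp_end zP) /early.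
rewrite [leRHS](bigID (fun l : 'I_m => c i <= l < k)%N) /= lerDl.
by apply: sumr_ge0 => l _; exact: lp_xe_ge0 zP t i l.
Qed.

(** The load subtracts [late] only for [k] in [[a i, b i]] and [early] only for [k] in [[c i, d i]].
    In the rest of the window [[a i, d i]] they are zero, so all three sums can range over the same
    tasks. *)
Let slot_loadE k :
  lp_slot_load a b c d z k = \sum_t \sum_(i | (a i <= k <= d i)%N) contrib t i k.
Proof.
apply: eq_bigr => t _; rewrite !sumrB; congr (_ - _ - _).
  rewrite [RHS](bigID (fun i => k <= b i)%N) /= [X in _ + X]big1 ?addr0.
    apply: eq_bigl => i; case: (a i <= k)%N => //=.
    case: (leqP k (b i)) => [kb|]; rewrite ?andbF ?andbT//.
    by rewrite (leq_trans kb) ?(leq_trans _ (le_cd i)).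
  by move=> i /andP[_]; rewrite -ltnNge => /ltnW; exact: late0.
rewrite [RHS](bigID (fun i => c i <= k)%N) /= [X in _ + X]big1 ?addr0.
  apply: eq_bigl => i; rewrite andbC.
  case: (leqP (c i) k) => [ck|]; rewrite ?andbF// ?andbT.
  by rewrite (leq_trans _ ck)// (leq_trans (le_ab i)).
by move=> i /andP[_]; rewrite -ltnNge => /ltnW; exact: early0.
Qed.

Lemma lp_obj_le_hitting_set (J : {set 'I_m}) (kk : 'I_n -> 'I_m) :
  (forall i, w i = 1) -> slot_assignment a d J kk ->
  lp_obj w z <= #|J|%:R + \sum_i
    (\sum_(l < m | (kk i < l <= b i)%N) Ps i l +
     \sum_(l < m | (c i <= l < kk i)%N) Pe i l).
Proof.
move=> w1 kkP.
have -> : lp_obj w z = \sum_i \sum_t contrib t i (kk i) +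
    \sum_i (\sum_t late t i (kk i) + \sum_t early t i (kk i)).
  rewrite /lp_obj exchange_big -big_split; apply: eq_bigr => i _ /=.
  rewrite -!big_split; apply: eq_bigr => t _ /=.
  by rewrite w1 mul1r /contrib -(addrA (lp_x z t i)) -opprD subrK.
apply: lerD; last first.
  (* Summed over the stages, the start and end masses at each slot are capped by [Ps] and [Pe]. *)
  apply: ler_sum => i _; apply: lerD; rewrite exchange_big; apply: ler_sum => l _.
    exact: lp_xs_le zP i l.
  exact: lp_xe_le zP i l.
apply: (@le_trans _ _ (\sum_(k in J) lp_slot_load a b c d z k)); last first.
  rewrite -sum1_card natr_sum; apply: ler_sum => k _; exact: lp_load zP k.
have -> : \sum_(k in J) lp_slot_load a b c d z k =
    \sum_i \sum_(k in J | (a i <= k <= d i)%N) \sum_t contrib t i k.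
  under eq_bigr do rewrite slot_loadE exchange_big.
  by rewrite (exchange_big_dep predT).
(* A window may contain several slots of [J]; those other than [kk i] only add nonnegative
   contributions, so any choice of [kk i] works. *)
apply: ler_sum => i _; rewrite (bigD1 (kk i)) /=; last by apply/andP; exact: kkP.
by rewrite lerDl; apply: sumr_ge0 => k _; apply: sumr_ge0 => t _.
Qed.

End LPBound.

(** The bound is stated for every minimum cover [J] and every choice [kk], which includes the case
    where each window contains a single slot of [J] and [kk] is forced. *)
Theorem mainTheorem7 (R : realType) (disp : measure_display)
    (Omega : measurableType disp) (P : probability Omega R) (m n : nat)
    (s e : 'I_n -> Omega -> 'I_m) (w : 'I_n -> R)
    (s_rv : forall i, slot_rv (s i))
    (e_rv : forall i, slot_rv (e i))
    (se_indep : forall i, slot_indep P (s i) (e i))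
    (se_le : forall i, (supp_max P (s i) <= supp_min P (e i))%N)
    (w1 : forall i, w i = 1) :
  let a := fun i => supp_min P (s i) in
  let b := fun i => supp_max P (s i) in
  let c := fun i => supp_min P (e i) in
  let d := fun i => supp_max P (e i) in
  let Ps := fun i => slot_pmf P (s i) in
  let Pe := fun i => slot_pmf P (e i) in
  let Po := fun i => prob_occupied P (s i) (e i) in
  let alpha_pes := independence_number (interval_graph a d) in
  let alpha := lp_value w a b c d Ps Pe in
  (exists (J : {set 'I_m}) (kk : 'I_n -> 'I_m),
      slot_cover a d J /\ slot_assignment a d J kk) /\
  (forall (J : {set 'I_m}) (kk : 'I_n -> 'I_m),
      slot_cover a d J -> slot_assignment a d J kk ->
      alpha <= alpha_pes%:R + \sum_(i < n) (1 - Po i (kk i))).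
Proof.
move=> a b c d Ps Pe Po alpha_pes alpha.
have le_ab i : (a i <= b i)%N by exact: supp_min_le_max.
have le_cd i : (c i <= d i)%N by exact: supp_min_le_max.
split.
  apply: slot_cover_assignment_exists => i; last exact: supp_max_lt.
  exact: leq_trans (leq_trans (le_ab i) (se_le i)) (le_cd i).
move=> J kk [cardJ _] kkP.
have le_obj z : lp_feasible a b c d Ps Pe z ->
    lp_obj w z <= alpha_pes%:R + \sum_(i < n) (1 - Po i (kk i)).
  move=> zP; apply: le_trans (lp_obj_le_hitting_set le_ab se_le le_cd zP w1 kkP) _.
  rewrite cardJ lerD2l; apply: ler_sum => i _.
  exact: sum_slot_pmf_le_unoccupied (s_rv i) (e_rv i) (se_le i).
rewrite /alpha /lp_value.
(* The supremum of the empty set is 0 by convention; the bound still holds there because each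
   [1 - Po i (kk i)] is nonnegative. *)
set V := (X in sup X); have [->|V0] := eqVneq V set0.
  rewrite sup0 addr_ge0// sumr_ge0// => i _.
  by rewrite subr_ge0 prob_occupied_le1.
by apply: ge_sup; [exact/set0P | move=> _ [z zP <-]; exact: le_obj].
Qed.
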